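(* Let $N\ge2$ and $k\in\,]0,\infty[$. Let $Z=(Z_1,\ldots,Z_N)$ be an $\mathbb A_N$-valued random variable with the distribution $\mu_k$ of a circular $\beta$-ensemble. Then for each $y\in\mathbb C$, $$\mathbb E\Bigl(\prod_{j=1}^N(y-Z_j)\Bigr)=y^N.$$
   Context: $\mathbb T$ is the complex unit circle and $\mathbb A_N=\{(e^{ix_1},\ldots,e^{ix_N}):\ x\in\mathbb R^N,\ x_1\le x_2\le\ldots\le x_N\le x_1+2\pi\}\subset\mathbb T^N$. The probability measure $\mu_k$ on $\mathbb A_N$ is $d\mu_k(z)=c_k\prod_{j,l:\,l\ne j}|z_j-z_l|^k\cdot\mathbf 1_{\mathbb A_N}(z)\,dz$, where the product is over all ordered pairs $(j,l)$ with $j\neq l$, $dz$ is the Haar measure on $\mathbb T^N$, and $c_k>0$ is the normalization constant. *)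

(* Defs.v *)
From HB Require Import structures.
From mathcomp Require Import all_boot all_order all_algebra.
From mathcomp Require Export complex.
From mathcomp Require Export all_classical all_reals all_analysis.

Set Implicit Arguments.
Unset Strict Implicit.
Unset Printing Implicit Defensive.
Import Order.TTheory GRing.Theory Num.Theory.
Import numFieldNormedType.Exports.

Local Open Scope classical_set_scope.
Local Open Scope ring_scope.
Local Open Scope complex_scope.

Record circle (R : realType) : Type := Circle {
  circle_val :> R[i];
  circle_valP : `|circle_val| == 1 }.

HB.instance Definition _ (R : realType) := [isSub for @circle_val R].
HB.instance Definition _ (R : realType) := [Choice of circle R by <:].

Lemma circle1_subproof (R : realType) : `|1 : R[i]| == 1.
Proof. by rewrite normr1. Qed.

HB.instance Definition _ (R : realType) :=
  isPointed.Build (circle R) (Circle (circle1_subproof R)).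

Lemma circle_mul_subproof (R : realType) (u v : circle R) :
  `|(u : R[i]) * (v : R[i])| == 1.
Proof.
by rewrite normrM (eqP (circle_valP u)) (eqP (circle_valP v)) mulr1.
Qed.

Definition circle_mul (R : realType) (u v : circle R) : circle R :=
  Circle (circle_mul_subproof u v).

Definition circle_coord (R : realType) (z : circle R) : R * R :=
  (complex.Re (z : R[i]), complex.Im (z : R[i])).

(* The Borel sigma-algebra of the circle: traces of the Borel sets of R^2.
   As the circle is second countable, the library's product sigma-algebra on
   n.-tuple (circle R) is the Borel sigma-algebra of the torus. *)
Notation circle_borel R :=
  (g_sigma_algebra_preimageType (@circle_coord R)).

HB.instance Definition _ (R : realType) :=
  @isMeasurable.Build (preimage_display (@circle_coord R)) (circle R)
    (@measurable _ (circle_borel R)) (@measurable0 _ (circle_borel R))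
    (@measurableC _ (circle_borel R))
    (@bigcupT_measurable _ (circle_borel R)).

Notation torus R N := (N.-tuple (circle R)).

Definition torus_mul (R : realType) (N : nat) (u z : torus R N) : torus R N :=
  [tuple circle_mul (tnth u j) (tnth z j) | j < N].

(* The normalized Haar measure: the translation-invariant Borel probability
   measure (regularity is automatic on a compact metrizable group). *)
Definition is_haar (R : realType) (N : nat)
    (haar : probability (torus R N) R) : Prop :=
  forall (u : torus R N) (B : set (torus R N)), measurable B ->
    haar (torus_mul u @` B) = haar B.

Definition expi (R : realType) (x : R) : R[i] := cos x +i* sin x.

Definition alcove (R : realType) (N : nat) : set (torus R N) :=
  [set z : torus R N | exists x : N.-tuple R,
    [/\ sorted <=%R x, last 0 x <= head 0 x + pi *+ 2 &
        forall j : 'I_N, tnth z j = expi (tnth x j) :> R[i]]].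

Definition circular_weight (R : realType) (N : nat) (k : R)
    (z : torus R N) : R :=
  (\prod_(j < N) \prod_(l < N | l != j)
     Normc.normc ((tnth z j : R[i]) - (tnth z l : R[i])) `^ k)
  * \1_(@alcove R N) z.

(* The integral is finite and positive for N >= 1 and k > 0, so the total
   functions [fine] and inverse are used at meaningful arguments only. *)
Definition circular_normalization (R : realType) (N : nat) (k : R)
    (haar : probability (torus R N) R) : R :=
  (fine (\int[haar]_z (circular_weight k z)%:E))^-1.

Definition circular_beta (R : realType) (N : nat) (k : R)
    (haar : probability (torus R N) R) (B : set (torus R N)) : \bar R :=
  ((circular_normalization k haar)%:E *
   \int[haar]_(z in B) (circular_weight k z)%:E)%E.

(* 'E_P[_] is a total operator: this is the expectation of X when X is
   P-integrable, in particular when X is bounded and measurable. *)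
Definition complex_expectation (R : realType) (d : measure_display)
    (Omega : measurableType d) (P : probability Omega R)
    (X : Omega -> R[i]) : R[i] :=
  fine 'E_P[fun w => complex.Re (X w)] +i* fine 'E_P[fun w => complex.Im (X w)].

(* Main.v *)
(** The weight [circular_weight] and the alcove are invariant under the diagonal
    rotations z |-> e^{it} z, hence so is the law of Z. Expanding the product
    over the subsets J of 'I_N, the monomial indexed by a nonempty J is
    multiplied by e^{it|J|} = -1 when t = pi / |J|, so its expectation equals
    its own opposite and vanishes; only the term y^N of the empty J remains. *)
From HB Require Import structures.
Require Import Defs.
From mathcomp Require Import all_boot all_order all_algebra.
From mathcomp Require Import measurable_realfun lra.
From mathcomp Require Import complex all_classical all_reals all_analysis.

Set Implicit Arguments.
Unset Strict Implicit.
Unset Printing Implicit Defensive.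
Import Order.TTheory GRing.Theory Num.Theory.
Import numFieldNormedType.Exports.

Local Open Scope classical_set_scope.
Local Open Scope ring_scope.
Local Open Scope complex_scope.

(** * Change of variables under measure-preserving maps *)

Section integral_preserving.
Local Open Scope ereal_scope.
Context d (T : measurableType d) (R : realType).
Variable mu : {measure set T -> \bar R}.
Import HBNNSimple.

Definition preserves (phi : T -> T) : Prop :=
  forall A, measurable A -> mu (phi @^-1` A) = mu A.

(* [f] need not be measurable: the integral is defined as a supremum over
   simple functions below [f], and these are transported by [phi]. This avoids
   proving that the alcove is measurable. *)
Lemma ge0_le_integral_comp (phi : {mfun T >-> T}) (f : T -> \bar R) :
  preserves phi -> (forall x, 0 <= f x) ->
  \int[mu]_x f x <= \int[mu]_x f (phi x).
Proof.
move=> mu_phi f0; rewrite !ge0_integralTE//.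
apply: ereal_sup_le => _ [h /= hf <-].
have fin_hphi : finite_set (range (h \o phi)).
  apply: sub_finite_set (fimfunP h) => _ [x _ <-] /=.
  by exists (phi x).
pose hphi : {nnsfun T >-> R} := HB.pack (h \o phi)
  (isMeasurableFun.Build _ _ _ _ (h \o phi)
    (measurableT_comp (measurable_funPT h) (measurable_funPT phi)))
  (FiniteImage.Build _ _ (h \o phi) fin_hphi)
  (isNonNegFun.Build _ _ (h \o phi) (fun x => @fun_ge0 _ _ h (phi x))).
exists hphi => [x|]; first exact: hf.
apply: eq_fsbigr => x _; congr (_ * _).
by rewrite -[RHS]mu_phi.
Qed.

(** The inverse of a measure-preserving bijection preserves the measure too, so the one-sided bound
    applies to [phi] and to [psi]. The domain [D] is absorbed into the integrand by extending [f] by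
    zero. *)
Lemma ge0_integral_comp_preserves (phi psi : {mfun T >-> T}) (D : set T)
    (f : T -> \bar R) :
  cancel phi psi -> cancel psi phi -> preserves phi -> (forall x, 0 <= f x) ->
  \int[mu]_(x in phi @^-1` D) f (phi x) = \int[mu]_(x in D) f x.
Proof.
move=> phiK psiK mu_phi f0.
have mu_psi : preserves psi.
  move=> A mA; rewrite -mu_phi.
    by rewrite -comp_preimage (_ : psi \o phi = idfun)//; exact/funext.
  by rewrite -[X in measurable X]setTI; exact: measurable_funPT.
have fD0 x : 0 <= (f \_ D) x by rewrite /patch; case: ifP.
rewrite [LHS]integral_mkcond [RHS]integral_mkcond.
have -> : (fun x => f (phi x)) \_ (phi @^-1` D) = (f \_ D) \o phi.
  exact/funext.
apply/eqP; rewrite eq_le ge0_le_integral_comp// andbT.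
(* The reverse inequality: composing the left integrand with [psi] undoes [phi]. *)
apply: le_trans (ge0_le_integral_comp mu_psi _) _ => [x|]; first exact: fD0.
by under eq_integral do rewrite /= psiK.
Qed.

End integral_preserving.

(** * Unit complex exponentials and diagonal rotations of the torus *)

Section rotation.
Context {R : realType}.

Lemma expiD (s t : R) : expi (s + t) = expi s * expi t.
Proof. by rewrite /expi cosD sinD; simpc; rewrite [X in _ +i* X]addrC. Qed.

Lemma expi0 : expi (0 : R) = 1.
Proof. by rewrite /expi cos0 sin0. Qed.

Lemma expi_mulrn (t : R) (n : nat) : expi (t *+ n) = expi t ^+ n.
Proof. by elim: n => [|n IHn]; rewrite ?expi0// mulrS exprS expiD IHn. Qed.

Lemma expi_pi : expi (pi : R) = -1.
Proof. by rewrite /expi cospi sinpi; simpc. Qed.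

Lemma normc_expi (t : R) : Normc.normc (expi t) = 1.
Proof. by rewrite /= cos2Dsin2 sqrtr1. Qed.

Lemma norm_expi (t : R) : `|expi t| == 1.
Proof. by rewrite normc_def cos2Dsin2 sqrtr1. Qed.

Section torus.
Variable N : nat.
Implicit Types (s t : R) (z : torus R N).

(** Written as a translation by a constant tuple, so that [is_haar] applies to it directly. *)
Definition rotate t z : torus R N :=
  torus_mul [tuple Circle (norm_expi t) | _ < N] z.

Lemma tnth_rotate t z (j : 'I_N) :
  tnth (rotate t z) j = expi t * tnth z j :> R[i].
Proof. by rewrite !tnth_mktuple. Qed.

Lemma rotateK t : cancel (rotate t) (rotate (- t)).
Proof.
move=> z; apply: eq_from_tnth => j; apply: val_inj => /=.
by rewrite !tnth_rotate mulrA -expiD addNr expi0 mul1r.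
Qed.

Lemma rotateNK t : cancel (rotate (- t)) (rotate t).
Proof. by move=> z; rewrite -{1}[t]opprK rotateK. Qed.

(** Links [is_haar], which speaks of images, to [preserves], which speaks of preimages. *)
Lemma image_rotate t (B : set (torus R N)) :
  rotate t @` B = rotate (- t) @^-1` B.
Proof.
apply/seteqP; split => [_ [z Bz <-]|z Bz]/=; first by rewrite rotateK.
by exists (rotate (- t) z); rewrite ?rotateNK.
Qed.

End torus.

(** * Measurable bounded complex-valued functions *)

Lemma measurable_circle_coord : measurable_fun setT (@circle_coord R).
Proof. by move=> _ B mB; exists B. Qed.

Lemma measurable_to_circle d (T : measurableType d) (f : T -> circle R) :
  measurable_fun setT (@circle_coord R \o f) -> measurable_fun setT f.
Proof.
move=> mf _ _ [B mB <-]; rewrite !setTI -comp_preimage.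
rewrite -[X in measurable X]setTI.
exact: mf.
Qed.

(** A sufficient condition for integrability of both components under every probability; unlike
    integrability it is stable under products. *)
Definition mbounded d (T : measurableType d) (f : T -> R[i]) : Prop :=
  [/\ measurable_fun setT (fun x => complex.Re (f x)),
     measurable_fun setT (fun x => complex.Im (f x)) &
     exists M : R, forall x,
       `|complex.Re (f x)| <= M /\ `|complex.Im (f x)| <= M].

Lemma mbounded_cst d (T : measurableType d) (c : R[i]) :
  mbounded (fun _ : T => c).
Proof.
split; [exact: measurable_cst..|].
by exists (`|complex.Re c| + `|complex.Im c|) => _; rewrite lerDl lerDr.
Qed.

Lemma mboundedM d (T : measurableType d) (f g : T -> R[i]) :
  mbounded f -> mbounded g -> mbounded (fun x => f x * g x).
Proof.
move=> [mf1 mf2 [M Mf]] [mg1 mg2 [M' Mg]].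
have ReM (a b : R[i]) : complex.Re (a * b) =
  complex.Re a * complex.Re b - complex.Im a * complex.Im b.
  by case: a b => [? ?] [? ?].
have ImM (a b : R[i]) : complex.Im (a * b) =
  complex.Re a * complex.Im b + complex.Im a * complex.Re b.
  by case: a b => [? ?] [? ?].
split.
- under eq_fun do rewrite ReM.
  by apply: measurable_funB; apply: measurable_funM.
- under eq_fun do rewrite ImM.
  by apply: measurable_funD; apply: measurable_funM.
(* Each component of the product is a sum or difference of two real products, each bounded by
   [M * M']. *)
exists (M * M' + M * M') => x; case: (Mf x) (Mg x) => f1 f2 [g1 g2].
rewrite ReM ImM; split; [apply: le_trans (ler_normB _ _) _|
  apply: le_trans (ler_normD _ _) _];
  by rewrite !normrM; apply: lerD; apply: ler_pM.
Qed.

Lemma mbounded_prod d (T : measurableType d) (I : Type) (r : seq I)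
    (F : I -> T -> R[i]) :
  (forall i, mbounded (F i)) -> mbounded (fun x => \prod_(i <- r) F i x).
Proof.
move=> mF; elim: r => [|i r IHr].
  by under eq_fun do rewrite big_nil; exact: mbounded_cst.
by under eq_fun do rewrite big_cons; exact: mboundedM.
Qed.

Lemma mboundedN d (T : measurableType d) (f : T -> R[i]) :
  mbounded f -> mbounded (fun x => - f x).
Proof.
move=> mf; under eq_fun do rewrite -mulN1r.
by apply: mboundedM => //; exact: mbounded_cst.
Qed.

Lemma mbounded_circle d (T : measurableType d) (f : T -> circle R) :
  measurable_fun setT f -> mbounded (fun x => f x : R[i]).
Proof.
move=> mf.
have mc : measurable_fun setT (@circle_coord R \o f).
  by apply: measurableT_comp mf; exact: measurable_circle_coord.
split.
- exact: measurableT_comp (measurable_fst) mc.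
- exact: measurableT_comp (measurable_snd) mc.
exists 1 => x; case: (f x) => -[a b] /= /eqP.
rewrite normc_def => -[]/= ab1.
have {}ab1 : a ^+ 2 + b ^+ 2 = 1.
  by rewrite -[LHS]sqr_sqrtr ?ab1 ?expr1n// addr_ge0// sqr_ge0.
by split; rewrite -(@ler_pXn2r _ 2)// ?nnegrE// expr1n real_normK ?num_real//
  -ab1 ?lerDl ?lerDr sqr_ge0.
Qed.

(** * Measurability of rotations; invariance of the alcove and of the weight *)

Variable N : nat.
Implicit Types (s t : R) (z : torus R N).

Lemma measurable_rotate t : measurable_fun setT (@rotate N t).
Proof.
apply/measurable_fun_tnthP => j; apply: measurable_to_circle.
have mj : mbounded (fun z : torus R N => tnth (rotate t z) j : R[i]).
  under eq_fun do rewrite tnth_rotate.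
  apply: mboundedM; first exact: mbounded_cst.
  by apply: mbounded_circle; exact: measurable_tnth.
by case: mj => m1 m2 _; exact: measurable_fun_pair.
Qed.

HB.instance Definition _ t :=
  isMeasurableFun.Build _ _ _ _ (@rotate N t) (measurable_rotate t).

Lemma alcove_rotate t z : alcove z -> alcove (rotate t z).
Proof.
(* Shifting all angles by [t] keeps their order and their spread. *)
move=> [x [xs xl xz]]; exists (map_tuple (+%R t) x); split => [||j].
- by rewrite /= (homo_sorted _ _ xs)// => a b ab; rewrite lerD2l.
- case: x xs xl {xz} => -[|a x] /= _ _ xl; last by rewrite last_map addrAC; lra.
  (* For the empty tuple, [last] and [head] both take the default 0, which is not shifted by [t];
     the condition reads [0 <= pi *+ 2]. *)
  by rewrite add0r mulrn_wge0// pi_ge0.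
- by rewrite tnth_rotate tnth_map expiD xz.
Qed.

Lemma alcove_rotateE t z : alcove (rotate t z) <-> alcove z.
Proof.
split; last exact: alcove_rotate.
by move=> /(alcove_rotate (- t)); rewrite rotateK.
Qed.

Lemma circular_weight_ge0 (k : R) z : 0 <= circular_weight k z.
Proof.
rewrite mulr_ge0//; apply: prodr_ge0 => j _; apply: prodr_ge0 => l _.
exact: powR_ge0.
Qed.

(** A rotation multiplies every difference of coordinates by the same number of modulus one. *)
Lemma circular_weight_rotate (k : R) t z :
  circular_weight k (rotate t z) = circular_weight k z.
Proof.
rewrite /circular_weight !indicE; congr (_ * _%:R); last first.
  by congr nat_of_bool; apply/idP/idP; rewrite !inE alcove_rotateE.
apply: eq_bigr => j _; apply: eq_bigr => l _.
by rewrite !tnth_rotate -mulrBr Normc.normcM normc_expi mul1r.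
Qed.

End rotation.

(** * Rotation invariance of the circular ensemble *)

Section haar_invariance.
Context (R : realType) (N : nat) (k : R) (haar : probability (torus R N) R).

Lemma haar_preserves_rotate (t : R) :
  is_haar haar -> preserves haar (rotate t).
Proof.
by move=> haarP B mB; rewrite -[t]opprK -image_rotate; exact: haarP.
Qed.

(** Substitute [rotate t] in the integral: it preserves the Haar measure and leaves the weight
    unchanged. *)
Lemma circular_beta_rotate (t : R) (B : set (torus R N)) :
  is_haar haar ->
  circular_beta k haar (rotate t @^-1` B) = circular_beta k haar B.
Proof.
move=> haarP; rewrite /circular_beta; congr (_ * _)%E.
rewrite -(@ge0_integral_comp_preserves _ _ _ haar (rotate t) (rotate (- t)) B).
- by apply: eq_integral => z _; rewrite /= circular_weight_rotate.
- exact: rotateK.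
- exact: rotateNK.
- exact: haar_preserves_rotate.
- by move=> z; rewrite lee_fin circular_weight_ge0.
Qed.

End haar_invariance.

(** * Linearity of the complex expectation and its dependence on the law alone *)

Section expectation.
Context (R : realType) (d : measure_display) (Omega : measurableType d).
Variable P : probability Omega R.

Definition cintegrable (X : Omega -> R[i]) : Prop :=
  P.-integrable setT (fun w => (complex.Re (X w))%:E) /\
  P.-integrable setT (fun w => (complex.Im (X w))%:E).

Lemma mbounded_cintegrable (X : Omega -> R[i]) : mbounded X -> cintegrable X.
Proof.
move=> [m1 m2 [M XM]].
split; apply: measurable_bounded_integrable => //=;
  rewrite ?probability_setT ?ltry//; exists M; split;
  rewrite ?num_real// => M' MM' w _ /=;
  by case: (XM w) => h1 h2; apply: ltW; apply: le_lt_trans MM'.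
Qed.

Lemma complex_expectationE (X : Omega -> R[i]) :
  complex_expectation P X =
  (\int[P]_w complex.Re (X w)) +i* (\int[P]_w complex.Im (X w)).
Proof. by rewrite /complex_expectation unlock. Qed.

Lemma complex_expectation_cst (c : R[i]) :
  complex_expectation P (fun _ => c) = c.
Proof.
rewrite /complex_expectation (expectation_cst P (complex.Re c)).
rewrite (expectation_cst P (complex.Im c)).
by case: c.
Qed.

Lemma cintegrableD (X Y : Omega -> R[i]) :
  cintegrable X -> cintegrable Y -> cintegrable (fun w => X w + Y w).
Proof.
move=> [X1 X2] [Y1 Y2]; split.
- apply: eq_integrable (integrableD _ X1 Y1) => // w _ /=.
  by case: (X w) (Y w) => [? ?] [? ?].
- apply: eq_integrable (integrableD _ X2 Y2) => // w _ /=.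
  by case: (X w) (Y w) => [? ?] [? ?].
Qed.

Lemma complex_expectationD (X Y : Omega -> R[i]) :
  cintegrable X -> cintegrable Y ->
  complex_expectation P (fun w => X w + Y w) =
  complex_expectation P X + complex_expectation P Y.
Proof.
move=> [X1 X2] [Y1 Y2]; rewrite !complex_expectationE; simpc.
rewrite -!RintegralD//; congr (_ +i* _); apply: eq_Rintegral => w _;
  by case: (X w) (Y w) => [? ?] [? ?].
Qed.

Lemma complex_expectation_sum (I : Type) (r : seq I) (F : I -> Omega -> R[i]) :
  (forall i, cintegrable (F i)) ->
  complex_expectation P (fun w => \sum_(i <- r) F i w) =
  \sum_(i <- r) complex_expectation P (F i).
Proof.
(* Integrability of the partial sums is carried along the induction, since additivity requires it at
   each step. *)
move=> intF; suff [] : cintegrable (fun w => \sum_(i <- r) F i w) /\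
  complex_expectation P (fun w => \sum_(i <- r) F i w) =
  \sum_(i <- r) complex_expectation P (F i) by [].
elim: r => [|i r [intr IHr]].
  under eq_fun do rewrite big_nil; rewrite big_nil; split.
    by apply: mbounded_cintegrable; exact: mbounded_cst.
  exact: complex_expectation_cst.
under eq_fun do rewrite big_cons; rewrite big_cons; split.
  exact: cintegrableD.
by rewrite complex_expectationD// IHr.
Qed.

Lemma complex_expectationN (X : Omega -> R[i]) :
  cintegrable X ->
  complex_expectation P (fun w => - X w) = - complex_expectation P X.
Proof.
move=> [X1 X2]; rewrite !complex_expectationE; simpc.
rewrite -[in RHS]mulN1r -[X in _ = _ +i* X]mulN1r -!RintegralZl//.
congr (_ +i* _); apply: eq_Rintegral => w _;
  by case: (X w) => ? ?; rewrite /= mulN1r.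
Qed.

Variables (d' : measure_display) (T : measurableType d').

Lemma mbounded_comp (X : {RV P >-> T}) (f : T -> R[i]) :
  mbounded f -> mbounded (fun w => f (X w)).
Proof.
move=> [m1 m2 [M fM]]; split; last by exists M => w; exact: fM.
- exact: measurableT_comp m1 (measurable_funPT X).
- exact: measurableT_comp m2 (measurable_funPT X).
Qed.

(** Component by component, both sides are integrals of [f] against the laws of [X] and [Y]. *)
Lemma complex_expectation_distribution (X Y : {RV P >-> T}) (f : T -> R[i]) :
  mbounded f ->
  (forall B, measurable B -> distribution P X B = distribution P Y B) ->
  complex_expectation P (fun w => f (X w)) =
  complex_expectation P (fun w => f (Y w)).
Proof.
move=> mf XY; have [m1 m2 _] := mf.
have [X1 X2] := mbounded_cintegrable (mbounded_comp X mf).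
have [Y1 Y2] := mbounded_cintegrable (mbounded_comp Y mf).
have eqE (g : T -> R) : measurable_fun setT g ->
    P.-integrable setT (fun w => (g (X w))%:E) ->
    P.-integrable setT (fun w => (g (Y w))%:E) ->
    \int[P]_w g (X w) = \int[P]_w g (Y w).
  move=> /measurable_EFinP mg gX gY; congr fine.
  rewrite -(integral_distribution mg gX) -(integral_distribution mg gY).
  by apply: eq_measure_integral => B mB _; exact: XY.
rewrite !complex_expectationE; congr (_ +i* _).
- exact: (eqE (fun z => complex.Re (f z))).
- exact: (eqE (fun z => complex.Im (f z))).
Qed.

End expectation.

(** * Expansion over index subsets and cancellation *)

Theorem corollary3p10 (R : realType) (N : nat) (k : R)
    (haar : probability (torus R N) R)
    (d : measure_display) (Omega : measurableType d)
    (P : probability Omega R) (Z : {RV P >-> torus R N}) :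
  (2 <= N)%N -> 0 < k ->
  is_haar haar ->
  (forall w : Omega, alcove (Z w)) ->
  (forall B : set (torus R N), measurable B ->
     distribution P Z B = circular_beta k haar B) ->
  forall y : R[i],
    complex_expectation P
      (fun w => \prod_(j < N) (y - (tnth (Z w) j : R[i]))) = y ^+ N.
Proof.
move=> _ _ haarP _ ZP y.
pose F (J : {set 'I_N}) (z : torus R N) : R[i] :=
  \prod_(j < N) (if j \in J then - (tnth z j : R[i]) else y).
have mF J : mbounded (F J).
  apply: mbounded_prod => j; case: (j \in J); last exact: mbounded_cst.
  by apply: mboundedN; apply: mbounded_circle; exact: measurable_tnth.
have intF J : cintegrable P (fun w => F J (Z w)).
  by apply: mbounded_cintegrable; exact: mbounded_comp.
have -> : (fun w => \prod_(j < N) (y - (tnth (Z w) j : R[i]))) =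
    fun w => \sum_(J : {set 'I_N}) F J (Z w).
  (* [bigA_distr] picks the first summand on [J], so the negated coordinate is moved in front of
     [y]. *)
  apply/funext => w; under eq_bigr do rewrite addrC.
  exact: bigA_distr.
rewrite complex_expectation_sum// (bigD1 (finset.set0 : {set 'I_N}))//=.
rewrite [X in X + _](_ : _ = y ^+ N); last first.
  rewrite -[RHS](complex_expectation_cst P); congr complex_expectation.
  apply/funext => w; rewrite /F; under eq_bigr do rewrite finset.in_set0.
  by rewrite prodr_const card_ord.
rewrite big1 ?addr0// => J J0.
(* As [J] is nonempty, [t] times its cardinality is [pi], so the factors [expi t] gathered over [J]
   multiply to -1. *)
pose t : R := pi / #|J|%:R.
have rotF z : F J (rotate t z) = - F J z.
  have -> : F J (rotate t z) =
      \prod_(j < N) (if j \in J then expi t else 1) * F J z.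
    rewrite -big_split/=; apply: eq_bigr => j _.
    by case: ifP => _; rewrite ?mul1r// tnth_rotate mulrN.
  rewrite -big_mkcond/= prodr_const -expi_mulrn -[_ *+ _]mulr_natr divfK.
    by rewrite expi_pi mulN1r.
  by rewrite pnatr_eq0 cards_eq0.
have : complex_expectation P (fun w => F J (Z w)) =
    complex_expectation P (fun w => F J ((rotate t \o Z) w)).
  apply: complex_expectation_distribution => // B mB.
  (* The law of [rotate t \o Z] at [B] is by definition the law of [Z] at the preimage of [B] under
     [rotate t]. *)
  rewrite ZP// -(circular_beta_rotate k t B haarP) -ZP//.
  by rewrite -[X in measurable X]setTI; exact: measurable_rotate.
under [in RHS]eq_fun do rewrite /= rotF.
(* The expectation equals its opposite, so its double is zero. *)
rewrite complex_expectationN// => /eqP.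
by rewrite -addr_eq0 -mulr2n mulrn_eq0/= => /eqP.
Qed.
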